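(* Let $G$ be a finite group or a compact Lie group, let $\mathcal{H}_A$ be a Hilbert space of finite dimension $d$ with orthonormal basis $\{|i\rangle\}_{i=1}^{d}$, and let $\Theta: G\to \mathsf{U}(\mathcal{H}_A)$ be a unitary representation with matrix elements $\Theta(g)_{i,i'}=\langle i|\Theta(g)|i'\rangle$. Let $A=\{A^i\}_{i=1}^{d}$ be a tensor of $D\times D$ complex matrices in canonical form (CF). Suppose that the matrix product vector generated by $A$ has a local symmetry with respect to $\Theta$, i.e. for all $N\in\mathbb{N}$ and all $g_1,\dots,g_N\in G$, $$\Theta(g_1)\otimes\Theta(g_2)\otimes\cdots\otimes\Theta(g_N)\,|\psi^N_A\rangle=|\psi^N_A\rangle .$$ Then for all $g\in G$ and all $i=1,\dots,d$, $$\sum_{i'}\Theta(g)_{i,i'}A^{i'}=A^i .$$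
   Context: A tensor $A=\{A^i\}_{i=1}^d$ of $D\times D$ complex matrices generates, for each $N$, the matrix product vector (MPV) $|\psi_A^N\rangle=\sum_{i_1,\dots,i_N}\operatorname{Tr}(A^{i_1}A^{i_2}\cdots A^{i_N})\,|i_1 i_2\dots i_N\rangle\in\mathcal{H}_A^{\otimes N}$. The completely positive map associated with $A$ is $E_A(X)=\sum_{i=1}^{d}A^iX(A^i)^\dagger$. A tensor $A$ is normal if there is $L\in\mathbb{N}$ such that the products $A^{i_1}\cdots A^{i_L}$ ($i_1,\dots,i_L\in\{1,\dots,d\}$) span the full algebra of $D\times D$ matrices and, in addition, the spectral radius of $E_A$ equals $1$. A tensor $A$ is in canonical form (CF) if $A^i=\bigoplus_{k=1}^n\nu_kA^i_k$ for all $i$, where each $A_k=\{A_k^i\}_i$ is a normal tensor and $\nu_k$ are constants. *)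

(* Defs.v *)
From HB Require Import structures.
From mathcomp Require Import all_boot all_order all_algebra spectral.
From mathcomp Require Import all_classical all_reals all_analysis.
From mathcomp Require Import complex.

Set Implicit Arguments.
Unset Strict Implicit.
Unset Printing Implicit Defensive.

Import Order.TTheory GRing.Theory Num.Theory.
Import numFieldNormedType.Exports.

Local Open Scope classical_set_scope.
Local Open Scope ring_scope.
Local Open Scope sesquilinear_scope.

(* A group whose carrier also bears a topology.  No compatibility is imposed
   here: it is part of [lie_group] below, and is irrelevant for finite groups. *)
#[short(type="groupTopologyType")]
HB.structure Definition GroupTopology := {G of Group G & Topological G}.

(* [C_on k U f]: f is of class C^k on the open set U.  For open U only the
   values of f on U matter, so that maps are taken total throughout. *)
Fixpoint C_on (R : realType) (m n k : nat) (U : set 'rV[R]_m)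
    (f : 'rV[R]_m -> 'rV[R]_n) : Prop :=
  (forall x, U x -> {for x, continuous f}) /\
  (if k is k'.+1 then
     forall v : 'rV[R]_m,
       (forall x, U x -> derivable f x v) /\ C_on k' U (fun x => 'D_v f x)
   else True).

Definition smooth_on (R : realType) (m n : nat) (U : set 'rV[R]_m)
    (f : 'rV[R]_m -> 'rV[R]_n) : Prop :=
  forall k, C_on k U f.

Record chart (R : realType) (T : topologicalType) (n : nat) := Chart {
  chart_dom : set T;
  chart_cod : set 'rV[R]_n;
  chart_map : T -> 'rV[R]_n;
  chart_inv : 'rV[R]_n -> T;
  chart_dom_open : open chart_dom;
  chart_cod_open : open chart_cod;
  chart_mapP : forall x, chart_dom x -> chart_cod (chart_map x);
  chart_invP : forall y, chart_cod y -> chart_dom (chart_inv y);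
  chart_mapK : forall x, chart_dom x -> chart_inv (chart_map x) = x;
  chart_invK : forall y, chart_cod y -> chart_map (chart_inv y) = y;
  chart_map_continuous :
    forall x, chart_dom x -> {for x, continuous chart_map};
  chart_inv_continuous :
    forall y, chart_cod y -> {for y, continuous chart_inv}
}.

Definition smooth_atlas (R : realType) (T : topologicalType) (n : nat)
    (S : set (chart R T n)) : Prop :=
  (forall x : T, exists2 a, S a & chart_dom a x) /\
  (forall a b, S a -> S b ->
     smooth_on [set y | chart_cod a y /\ chart_dom b (chart_inv a y)]
               (fun y => chart_map b (chart_inv a y))).

(* The inverse and the multiplication are read in charts; a point of a product
   chart is a row vector of size n + n.  The domains in the two smoothness
   conditions are open because the operations are required to be continuous. *)
Definition lie_group (R : realType) (G : groupTopologyType) : Prop :=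
  [/\ hausdorff_space G,
      @second_countable G,
      continuous (fun p : G * G => (p.1 * p.2)%g),
      continuous (fun x : G => (x^-1)%g) &
      exists (n : nat) (S : set (chart R G n)),
      [/\ smooth_atlas S,
          (forall a b c, S a -> S b -> S c ->
             smooth_on
               [set z : 'rV[R]_(n + n) |
                  [/\ chart_cod a (lsubmx z), chart_cod b (rsubmx z) &
                      chart_dom c (chart_inv a (lsubmx z)
                                   * chart_inv b (rsubmx z))%g]]
               (fun z => chart_map c (chart_inv a (lsubmx z)
                                      * chart_inv b (rsubmx z))%g)) &
          (forall a b, S a -> S b ->
             smooth_on
               [set y | chart_cod a y /\ chart_dom b (chart_inv a y)^-1%g]
               (fun y => chart_map b (chart_inv a y)^-1%g))]].

Definition compact_lie_group (R : realType) (G : groupTopologyType) : Prop :=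
  lie_group R G /\ compact [set: G].

(* The Hilbert space of dimension d is C^d with its standard orthonormal basis,
   so that Theta g i i' is the matrix element <i|Theta(g)|i'>. *)
Definition unitary_representation (R : realType) (G : groupType) (d : nat)
    (Theta : G -> 'M[R[i]]_d) : Prop :=
  [/\ Theta 1%g = 1%:M,
      (forall g h, Theta (g * h)%g = Theta g *m Theta h) &
      (forall g, Theta g \is unitarymx)].

Definition continuous_representation (R : realType) (G : groupTopologyType)
    (d : nat) (Theta : G -> 'M[R[i]]_d) : Prop :=
  continuous (Theta : G -> 'M[(R[i] : numFieldType)]_d).

Definition tensor (R : realType) (d D : nat) := 'I_d -> 'M[R[i]]_D.

(* The N-fold tensor power of C^d, in coordinates: the component of a vector
   on |i_1 ... i_N> is its value at the function k |-> i_k. *)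
Definition tensor_power (R : realType) (d N : nat) :=
  {ffun {ffun 'I_N -> 'I_d} -> R[i]}.

Definition mpv (R : realType) (d D : nat) (A : tensor R d D) (N : nat) :
    tensor_power R d N :=
  [ffun w : {ffun 'I_N -> 'I_d} => \tr (\prod_(k < N) A (w k))].

(* The action of U_1 (x) ... (x) U_N on the N-fold tensor power. *)
Definition tensor_op (R : realType) (d N : nat) (U : 'I_N -> 'M[R[i]]_d)
    (psi : tensor_power R d N) : tensor_power R d N :=
  [ffun w : {ffun 'I_N -> 'I_d} =>
     \sum_(w' : {ffun 'I_N -> 'I_d}) (\prod_(k < N) U k (w k) (w' k)) * psi w'].

Definition cp_map (R : realType) (d D : nat) (A : tensor R d D)
    (X : 'M[R[i]]_D) : 'M[R[i]]_D :=
  \sum_(i < d) A i *m X *m (A i)^t*.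

Definition spectral_radius (R : realType) (n : nat) (M : 'M[R[i]]_n) : R :=
  sup [set ComplexField.Normc.normc a | a in [set a | eigenvalue M a]].

(* [lin_mx] is the matrix of the linear map [cp_map A] on the D^2-dimensional
   space of matrices. *)
Definition normal_tensor (R : realType) (d D : nat) (A : tensor R d D) : Prop :=
  (exists L : nat,
     <<[seq \prod_(k < L) A (w k) | w : {ffun 'I_L -> 'I_d}]>>%VS
       = fullv :> {vspace 'M[R[i]]_D}) /\
  spectral_radius (lin_mx (cp_map A)) = 1.

Definition in_canonical_form (R : realType) (d D : nat) (A : tensor R d D) : Prop :=
  exists (n : nat) (Dk : 'I_n -> nat) (eD : (\sum_k Dk k)%N = D)
         (nu : 'I_n -> R[i]) (Ak : forall k, tensor R d (Dk k)),
    (forall k, normal_tensor (Ak k)) /\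
    (forall i, A i = castmx (eD, eD) (\mxdiag_k (nu k *: Ak k i))).

Definition local_symmetry (R : realType) (G : groupType) (d D : nat)
    (Theta : G -> 'M[R[i]]_d) (A : tensor R d D) : Prop :=
  forall (N : nat) (g : 'I_N -> G),
    tensor_op (fun k => Theta (g k)) (mpv A N) = mpv A N.

(* Main.v *)
(* Acting with [g] on a single site
   shows that [C := \sum_i' Theta g i i' *: A i' - A i] is orthogonal, for the
   trace form, to every word in the [A j], hence to the algebra they generate.
   As [C] lies in that algebra, all the powers of [C X] are traceless for every
   [X] in it, so [C X] is nilpotent.  By normality, the algebra projects onto the
   full matrix algebra of each block with nonzero weight, and some [C X] would
   not be nilpotent if the block of [C] were nonzero. *)
Require Import Defs.
From HB Require Import structures.
From mathcomp Require Import all_boot all_order all_algebra.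
From mathcomp Require Import all_classical all_reals all_analysis.
From mathcomp Require Import complex.

Set Implicit Arguments.
Unset Strict Implicit.
Unset Printing Implicit Defensive.

Import Order.TTheory GRing.Theory Num.Theory.

Local Open Scope classical_set_scope.
Local Open Scope ring_scope.

(** * Nilpotency from vanishing traces *)

(** In the full-rank factorization of [E] into [col_base E] and [row_base E], idempotence makes the
    product in reverse order an identity matrix of size [\rank E]; the trace is cyclic. *)
Lemma mxtrace_idempotent (F : fieldType) (n : nat) (E : 'M[F]_n) :
  E *m E = E -> \tr E = (\rank E)%:R.
Proof.
move=> EE; have rcE : row_base E *m col_base E = 1%:M.
  apply: (row_full_inj (col_base_full E)); rewrite mulmx1.
  apply: (row_free_inj (row_base_free E)).
  by rewrite mulmx_base mulmxA mulmx_base -mulmxA mulmx_base.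
by rewrite -{1}(mulmx_base E) mxtrace_mulC rcE mxtrace1.
Qed.

(** The projector onto the part where [M] is invertible is a polynomial in [M] without constant
    term, hence traceless. Its trace is also its rank, so in characteristic 0 it vanishes. *)
Lemma mxtrace_pow0_nilpotent (F : fieldType) (n : nat) (M : 'M[F]_n) :
  [pchar F] =i pred0 -> (forall k, \tr (M ^+ k.+1) = 0) ->
  exists k, M ^+ k = 0.
Proof.
case: n M => [|n] M F0 trM; first by exists 0; apply: flatmx0.
have [a [q]] := multiplicity_XsubC (char_poly M) 0.
rewrite monic_neq0 ?char_poly_monic //= => q0 pE.
(* The exponent is [a.+1] rather than [a] so that [e] below has no constant term even when 0 is not
   an eigenvalue of [M]. *)
have : coprimep ('X ^+ a.+1) q.
  by apply: coprimep_expl; rewrite coprimep_sym coprimepX.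
case/Bezout_eq1_coprimepP => -[u v] /= uv1.
have qM : horner_mx M (q * 'X ^+ a.+1) = 0.
  rewrite exprSr mulrA -['X]subr0 -pE rmorphM /=.
  by rewrite Cayley_Hamilton mul0r.
pose e := u * 'X ^+ a.+1.
have eE : 1 - e = v * q by rewrite -uv1 addrC addKr.
(* [horner_mx M e] projects onto the image of [M ^+ a.+1] along its kernel. *)
have absorb p : horner_mx M (p * 'X ^+ a.+1 * e) = horner_mx M (p * 'X ^+ a.+1).
  apply/eqP; rewrite eq_sym -subr_eq0 -rmorphB -{1}[p * _]mulr1 -mulrBr eE.
  by rewrite mulrACA [_ * q]mulrC rmorphM /= qM mulr0.
have tre : \tr (horner_mx M e) = 0.
  rewrite /e exprS mulrA -[u * 'X]coefK poly_def mulr_suml rmorph_sum raddf_sum.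
  rewrite /= big1 // => i _.
  rewrite -scalerAl -exprD linearZ rmorphXn /= horner_mx_X mxtraceZ.
  by case: i => -[|i] /= _; rewrite ?coefMX ?mul0r // addSn trM mulr0.
have e0 : horner_mx M e = 0.
  apply/eqP; rewrite -mxrank_eq0; have := F0; move/pcharf0P <-.
  rewrite -mxtrace_idempotent ?tre //.
  by rewrite -[LHS](rmorphM (horner_mx M)); apply: absorb.
exists a.+1; have := absorb 1.
by rewrite rmorphM /= e0 mulr0 mul1r rmorphXn /= horner_mx_X.
Qed.

(** [delta_mx b a] has rank one: it is a column times a row, and the factors around [X] collapse to
    one entry. *)
Lemma delta_mx_sandwich (F : comPzRingType) (m n : nat) (X : 'M[F]_(m, n)) a b :
  delta_mx b a *m X *m delta_mx b a = X a b *: delta_mx b a.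
Proof.
have E : delta_mx b a = delta_mx b 0 *m delta_mx (0 : 'I_1) a :> 'M[F]_(n, m).
  by rewrite mul_delta_mx.
rewrite {1 2}E -!mulmxA (mulmxA X) -colE (mulmxA (delta_mx 0 a)) -rowE.
by rewrite [row a _]mx11_scalar !mxE mul_scalar_mx -scalemxAr mul_delta_mx.
Qed.

(** * The unital algebra generated by a family of matrices *)

(** The inductive form lets trace orthogonality and the lifting from one block be proved by
    induction on how an element is built. *)
Inductive in_algebra (F : pzRingType) (n : nat) (I : Type) (A : I -> 'M[F]_n) :
    'M[F]_n -> Prop :=
  | in_algebra1 : in_algebra A 1%:M
  | in_algebra_gen i : in_algebra A (A i)
  | in_algebraM X Y :
      in_algebra A X -> in_algebra A Y -> in_algebra A (X *m Y)
  | in_algebra_lin a X Y :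
      in_algebra A X -> in_algebra A Y -> in_algebra A (a *: X + Y).

Section GeneratedAlgebra.
Variables (F : pzRingType) (n : nat) (I : Type) (A : I -> 'M[F]_n).

Lemma in_algebra0 : in_algebra A 0.
Proof.
have := in_algebra_lin (-1) (in_algebra1 A) (in_algebra1 A).
by rewrite scaleN1r addNr.
Qed.

Lemma in_algebraZ a X : in_algebra A X -> in_algebra A (a *: X).
Proof. by move/(in_algebra_lin a)/(_ in_algebra0); rewrite addr0. Qed.

Lemma in_algebraD X Y :
  in_algebra A X -> in_algebra A Y -> in_algebra A (X + Y).
Proof. by move=> X_A /(in_algebra_lin 1 X_A); rewrite scale1r. Qed.

Lemma in_algebra_sum (J : finType) (a : J -> F) (X : J -> 'M[F]_n) :
  (forall j, in_algebra A (X j)) -> in_algebra A (\sum_j a j *: X j).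
Proof.
move=> XA; apply: big_ind => [||j _]; first exact: in_algebra0.
  exact: in_algebraD.
exact: in_algebraZ.
Qed.

Lemma in_algebra_prod (J : Type) (r : seq J) (X : J -> 'M[F]_n) :
  (forall j, in_algebra A (X j)) -> in_algebra A (\prod_(j <- r) X j).
Proof.
by move=> XA; apply: big_ind => // [|*]; [apply: in_algebra1|apply: in_algebraM].
Qed.

Lemma in_algebraX X k : in_algebra A X -> in_algebra A (X ^+ k).
Proof.
move=> XA; elim: k => [|k IHk]; first exact: in_algebra1.
by rewrite exprS; apply: in_algebraM.
Qed.

End GeneratedAlgebra.

Lemma in_algebra_span (F : fieldType) (n : nat) (I : Type) (A : I -> 'M[F]_n)
    (s : seq 'M[F]_n) y :
  (forall x, x \in s -> in_algebra A x) -> y \in span s -> in_algebra A y.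
Proof.
move=> sA ys; rewrite (coord_span (X := in_tuple s) ys).
by apply: in_algebra_sum => i; apply/sA/mem_nth.
Qed.

Lemma in_algebra_trace0 (F : comPzRingType) (n : nat) (I : Type)
    (A : I -> 'M[F]_n) (C : 'M[F]_n) :
  (forall w : seq I, \tr (C *m \prod_(i <- w) A i) = 0) ->
  forall X, in_algebra A X -> \tr (C *m X) = 0.
Proof.
move=> C0 X XA.
(* The left factor must vary in the induction: for a product [X *m Y], the hypothesis on [Y] is
   applied with [Z *m X] in place of [Z]. *)
suff Xw Z : (forall w : seq I, \tr (Z *m \prod_(i <- w) A i) = 0) ->
    forall w : seq I, \tr (Z *m X *m \prod_(i <- w) A i) = 0.
  by have := Xw C C0 [::]; rewrite big_nil mulmx1.
elim: XA Z => {X} [|i|X Y _ IHX _ IHY|a X Y _ IHX _ IHY] Z Z0 w.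
- by rewrite mulmx1.
- by have := Z0 (i :: w); rewrite big_cons -mulmxA.
- by rewrite mulmxA; apply: IHY; apply: IHX.
- by rewrite mulmxDr mulmxDl linearD /= -scalemxAr -scalemxAl linearZ /=
    IHX // IHY // mulr0 addr0.
Qed.

(** * Block-diagonal algebras *)

Section BlockDiagonal.
Variables (F : pzRingType) (m : nat) (p : 'I_m -> nat).
Implicit Types X Y : forall k, 'M[F]_(p k).

Lemma mxdiagM X Y :
  mxdiag X *m mxdiag Y = \mxdiag_k (X k *m Y k).
Proof.
rewrite [mxdiag Y]/mxdiag mul_mxdiag_mxblock; apply: eq_mxblock => i j.
have [ij|] := eqVneq i j; last by rewrite mulmx0.
by rewrite ij !conform_mx_id.
Qed.

Lemma mxdiag1 : \mxdiag_k (1%:M : 'M[F]_(p k)) = 1%:M.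
Proof. exact: mxdiagZ. Qed.

Lemma mxdiagX X j : mxdiag X ^+ j = \mxdiag_k (X k ^+ j).
Proof.
elim: j => [|j IHj]; first by rewrite expr0 -[LHS]mxdiag1.
rewrite exprS IHj -[_ * _]/(_ *m _) mxdiagM.
by apply: eq_mxdiag => k; rewrite exprS.
Qed.

Lemma scale_mxdiag a X : a *: mxdiag X = \mxdiag_k (a *: X k).
Proof.
rewrite -mul_scalar_mx -mxdiagZ mxdiagM.
by apply: eq_mxdiag => k; rewrite mul_scalar_mx.
Qed.

(** The expression building [y] from generators is evaluated in all blocks at once. The other blocks
    of [Y] cannot be prescribed: two blocks may be equal, for instance. *)
Lemma in_algebra_mxdiag_lift (I : Type) (B : forall k, I -> 'M[F]_(p k)) k y :
  in_algebra (B k) y ->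
  exists2 Y, in_algebra (fun i => \mxdiag_k B k i) (mxdiag Y) & Y k = y.
Proof.
elim=> {y} [|i|y z _ [Y YA <-] _ [Z ZA <-]|a y z _ [Y YA <-] _ [Z ZA <-]].
- by exists (fun k => 1%:M); rewrite // mxdiag1; apply: in_algebra1.
- exists (fun k => B k i) => //.
  exact: (in_algebra_gen (fun i => \mxdiag_k B k i)).
- exists (fun k => Y k *m Z k) => //.
  by rewrite -mxdiagM; apply: in_algebraM.
- exists (fun k => a *: Y k + Z k) => //.
  by rewrite mxdiagD -scale_mxdiag; apply: in_algebra_lin.
Qed.

End BlockDiagonal.

Lemma trace_orthogonal_block0 (F : fieldType) (m : nat) (p : 'I_m -> nat)
    (I : Type) (B : forall k, I -> 'M[F]_(p k)) (C : forall k, 'M[F]_(p k)) k :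
  [pchar F] =i pred0 ->
  in_algebra (fun i => \mxdiag_k B k i) (mxdiag C) ->
  (forall X, in_algebra (fun i => \mxdiag_k B k i) X ->
     \tr (mxdiag C *m X) = 0) ->
  (forall y, in_algebra (B k) y) ->
  C k = 0.
Proof.
move=> F0 CA trC fullk; apply/matrixP => a b; rewrite mxE; apply/eqP.
apply: contraT => Cab.
(* This [Y] makes [C k *m Y k] a nonzero idempotent. *)
have [Y YA Yk] := in_algebra_mxdiag_lift (fullk ((C k a b)^-1 *: delta_mx b a)).
pose M := mxdiag C *m mxdiag Y.
have MA : in_algebra (fun i => \mxdiag_k B k i) M by apply: in_algebraM.
have [j] : exists j, M ^+ j = 0.
  apply: mxtrace_pow0_nilpotent => // j.
  rewrite exprS -[_ * _]/(_ *m _) -mulmxA; apply: trC.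
  by apply: in_algebraM => //; apply: in_algebraX.
rewrite /M mxdiagM mxdiagX -mxdiag0 => /eq_mxdiagP /(_ k) /=.
have YCY : Y k *m C k *m Y k = Y k.
  rewrite Yk -!scalemxAl -scalemxAr delta_mx_sandwich 2!scalerA.
  by rewrite mulfVK.
have -> : (C k *m Y k) ^+ j = if j is 0 then 1%:M else C k *m Y k.
  case: j => // j; elim: j => [|j IHj]; first by rewrite expr1.
  by rewrite exprS IHj -[LHS]/(_ *m _) -mulmxA (mulmxA (Y k)) YCY.
have CY0 : (C k *m Y k) a a != 0.
  rewrite Yk -scalemxAr mxE mxE (bigD1 b) //= mxE !eqxx big1 ?addr0 ?mulr1.
    by rewrite mulVf ?oner_eq0.
  by move=> i ib; rewrite mxE (negPf ib) mulr0.
(* The index [a] shows that the block is not of size 0, so the exponent 0 is excluded by the same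
   diagonal entry. *)
case: j => [|j] /matrixP /(_ a a) /eqP.
  by rewrite !mxE eqxx (oner_eq0 F).
by rewrite [X in _ == X]mxE (negPf CY0).
Qed.

(** * Matrix product vectors and their symmetry *)

Lemma prod_scalemx (F : comPzRingType) (n : nat) (J : Type) (r : seq J)
    (c : J -> F) (X : J -> 'M[F]_n) :
  \prod_(j <- r) (c j *: X j) = (\prod_(j <- r) c j) *: \prod_(j <- r) X j.
Proof.
elim: r => [|j r IHr]; first by rewrite !big_nil scale1r.
rewrite !big_cons IHr -[LHS]/(_ *m _) -scalemxAl -scalemxAr scalerA.
by [].
Qed.

(** The spanning words all have the same length [L], so rescaling the generators multiplies each of
    them by the nonzero constant [c ^+ L]. *)
Lemma normal_tensor_in_algebra (R : realType) (d D : nat) (A : tensor R d D)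
    (c : R[i]) y :
  normal_tensor A -> c != 0 -> in_algebra (fun i => c *: A i) y.
Proof.
case=> -[L spanA] _ c0; have := memvf y; rewrite -spanA.
apply: in_algebra_span => _ /fintype.imageP[w _ ->].
have -> : \prod_(k < L) A (w k) = c ^- L *: \prod_(k < L) (c *: A (w k)).
  by rewrite prod_scalemx prodr_const card_ord scalerA mulVf ?expf_neq0 ?scale1r.
apply/in_algebraZ/in_algebra_prod => k.
exact: (in_algebra_gen (fun i => c *: A i)).
Qed.

(** Site operators can be absorbed into the site matrices: distributing the product of sums recovers
    the sum over all words [w']. *)
Lemma tensor_op_mpv (R : realType) (d D N : nat) (U : 'I_N -> 'M[R[i]]_d)
    (A : tensor R d D) (w : {ffun 'I_N -> 'I_d}) :
  tensor_op U (mpv A N) w = \tr (\prod_(k < N) \sum_i U k (w k) i *: A i).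
Proof.
rewrite ffunE bigA_distr_bigA raddf_sum /=; apply: eq_bigr => w' _.
by rewrite prod_scalemx mxtraceZ ffunE.
Qed.

Lemma local_symmetry_trace0 (R : realType) (G : groupType) (d D : nat)
    (Theta : G -> 'M[R[i]]_d) (A : tensor R d D) (g : G) (i : 'I_d)
    (w : seq 'I_d) :
  Theta 1%g = 1%:M -> local_symmetry Theta A ->
  \tr ((\sum_i' Theta g i i' *: A i' - A i) *m \prod_(j <- w) A j) = 0.
Proof.
(* [g] acts on the first site of a chain of length [(size w).+1], the identity elsewhere, and the
   component on [i :: w] is read off. The default [i] of [nth] is never reached. *)
move=> Theta1 /(_ (size w).+1 (fun k => if k == ord0 then g else 1%g)).
move/ffunP/(_ [ffun k : 'I__ => nth i (i :: w) k]).
rewrite tensor_op_mpv [RHS]ffunE !big_ord_recl /= !ffunE /=.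
rewrite [X in _ *m X](big_nth i) big_mkord mulmxBl linearB /= => sym.
apply/eqP; rewrite subr_eq0; apply/eqP.
rewrite [X in _ * X](_ : _ = \prod_(k < size w) A (nth i w k)) in sym.
  apply: (etrans sym); congr (\tr (_ *m _)).
  by apply: eq_bigr => k _; rewrite ffunE.
apply: eq_bigr => k _; rewrite ffunE /= Theta1 (bigD1 (nth i w k)) //= mxE eqxx.
rewrite scale1r big1 ?addr0 // => j jw.
by rewrite mxE eq_sym (negPf jw) scale0r.
Qed.

Theorem theorem1 (R : realType) (G : groupTopologyType) (d D : nat)
    (Theta : G -> 'M[R[i]]_d) (A : tensor R d D)
    (Theta_unitary : unitary_representation Theta)
    (G_finite_or_lie :
       finite_set [set: G] \/
       (compact_lie_group R G /\ continuous_representation Theta))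
    (A_cf : in_canonical_form A)
    (A_sym : local_symmetry Theta A) :
  forall (g : G) (i : 'I_d), \sum_(i' < d) Theta g i i' *: A i' = A i.
Proof.
move=> g i; case: Theta_unitary => Theta1 _ _.
case: A_cf => m [p [eD [nu [Ak [Ak_normal AE]]]]].
case: D / eD A A_sym AE => A A_sym AE.
pose B k i := nu k *: Ak k i.
have {}AE : A = fun i => \mxdiag_k B k i.
  by apply/funext => j; rewrite AE castmx_id.
pose C k := \sum_(i' < d) Theta g i i' *: B k i' - B k i.
have CE : \sum_(i' < d) Theta g i i' *: A i' - A i = mxdiag C.
  rewrite AE mxdiagB mxdiag_sum; congr (_ - _).
  by apply: eq_bigr => j _; rewrite scale_mxdiag.
apply/eqP; rewrite -subr_eq0 CE -mxdiag0; apply/eqP/eq_mxdiagP => k.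
(* A block of weight zero need not generate its full matrix algebra, but there both terms of [C k]
   vanish. *)
have [nu0|nu_neq0] := eqVneq (nu k) 0.
  rewrite /C /B nu0 big1 ?scale0r ?subrr // => j _.
  by rewrite scale0r scaler0.
apply: (trace_orthogonal_block0 (B := B) (C := C)).
- exact: pchar_num.
- rewrite -AE -CE; apply: in_algebraD.
    by apply: in_algebra_sum => j; apply: in_algebra_gen.
  by rewrite -scaleN1r; apply/in_algebraZ/in_algebra_gen.
- rewrite -AE; apply: in_algebra_trace0 => w.
  by rewrite -CE; apply: local_symmetry_trace0.
- by move=> y; apply: normal_tensor_in_algebra.
Qed.
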